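(* For every pair of positive integers $k,\ell$ with $k\geq 3$, there exists a positive integer $N=N(k,\ell)$ such that for every integer $n\geq N$, $$rx_{k,\ell}(K_{n,n})=\begin{cases}3 & \text{if } k=3 \text{ and } \ell\in\{1,2\},\\ 4 & \text{if } k=3 \text{ and } \ell\geq 3,\\ k+1 & \text{if } k\geq 4.\end{cases}$$
   Context: All graphs are undirected, finite and simple. $K_{n,n}$ is the complete bipartite graph with both vertex classes of size $n$. An edge-coloring of a graph $G$ with $t$ colors is any map $c:E(G)\to\{1,\dots,t\}$ (adjacent edges may receive the same color). A tree $T$ that is a subgraph of $G$ is a rainbow tree if no two edges of $T$ have the same color. For $S\subseteq V(G)$, an $S$-tree is a tree in $G$ containing all vertices of $S$, and a rainbow $S$-tree is an $S$-tree that is a rainbow tree. Rainbow $S$-trees $T_1,\dots,T_\ell$ are internally disjoint if $E(T_i)\cap E(T_j)=\emptyset$ and $V(T_i)\cap V(T_j)=S$ for all $1\le i,j\le \ell$ with $i\neq j$. The $(k,\ell)$-rainbow index $rx_{k,\ell}(G)$ is the minimum number of colors needed in an edge-coloring of $G$ such that for every set $S$ of $k$ vertices of $G$ there exist $\ell$ internally disjoint rainbow $S$-trees. *)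

(* Defs.v *)
From mathcomp Require Import all_boot.

Set Implicit Arguments.
Unset Strict Implicit.
Unset Printing Implicit Defensive.

(* An edge xy is the two-element set [set x; y]. *)

Record sgraph := SGraph {
  vertex :> finType;
  adj : rel vertex;
  adj_sym : symmetric adj;
  adj_irrefl : irreflexive adj
}.

Definition edges (G : sgraph) : {set {set G}} :=
  [set e | [exists x : G, exists y : G, adj x y && (e == [set x; y])]].

Record subgraph (G : sgraph) := Subgraph {
  sub_verts : {set G};
  sub_edges : {set {set G}};
  sub_edgesP : sub_edges \subset edges G;
  sub_endsP : forall e, e \in sub_edges -> e \subset sub_verts
}.

Section Trees.
Variables (G : sgraph) (T : subgraph G).

Definition sub_adj : rel G := [rel x y | [set x; y] \in sub_edges T].

Definition connected_sub : Prop :=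
  forall x y, x \in sub_verts T -> y \in sub_verts T -> connect sub_adj x y.

(* A cycle is given by its list of at least three distinct vertices. *)
Definition acyclic_sub : Prop :=
  ~ exists p : seq G, 2 < size p /\ ucycle sub_adj p.

Definition is_tree : Prop :=
  [/\ sub_verts T != set0, connected_sub & acyclic_sub].

Definition is_Stree (S : {set G}) : Prop := is_tree /\ S \subset sub_verts T.

Definition is_rainbow (c : {set G} -> nat) : Prop :=
  {in sub_edges T &, injective c}.

End Trees.

(* Maps E(G) -> {1, ..., t}; values of c outside edges G are irrelevant. *)
Definition edge_coloring (G : sgraph) (t : nat) (c : {set G} -> nat) : Prop :=
  forall e, e \in edges G -> 1 <= c e <= t.

Definition internally_disjoint (G : sgraph) (S : {set G}) (l : nat)
    (T : 'I_l -> subgraph G) : Prop :=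
  forall i j, i != j ->
    sub_edges (T i) :&: sub_edges (T j) = set0 /\
    sub_verts (T i) :&: sub_verts (T j) = S.

Definition rainbow_connecting (G : sgraph) (k l : nat) (c : {set G} -> nat)
    : Prop :=
  forall S : {set G}, #|S| = k ->
    exists T : 'I_l -> subgraph G,
      (forall i, is_Stree (T i) S /\ is_rainbow (T i) c) /\
      internally_disjoint S T.

Definition colors_suffice (G : sgraph) (k l t : nat) : Prop :=
  exists c : {set G} -> nat, edge_coloring t c /\ rainbow_connecting k l c.

(* rx_{k,l}(G) = t.  A relation, since the minimum is over a set of t which is
   empty for some G; the relation then holds for no t. *)
Definition rainbow_index (G : sgraph) (k l t : nat) : Prop :=
  colors_suffice G k l t /\ forall t', colors_suffice G k l t' -> t <= t'.

Definition Knn_adj (n : nat) : rel ('I_n + 'I_n) :=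
  fun u v => match u, v with
             | inl _, inr _ | inr _, inl _ => true
             | _, _ => false
             end.

Lemma Knn_sym n : symmetric (@Knn_adj n).
Proof. by move=> [x|x] [y|y]. Qed.

Lemma Knn_irrefl n : irreflexive (@Knn_adj n).
Proof. by move=> [x|x]. Qed.

Definition Knn (n : nat) : sgraph := SGraph (@Knn_sym n) (@Knn_irrefl n).

(* Main.v *)
Require Import Defs.
From mathcomp Require Import all_boot.
From mathcomp Require Import zify.

Set Implicit Arguments.
Unset Strict Implicit.
Unset Printing Implicit Defensive.

(* Lower bounds: a rainbow tree on t colours has at most t + 1 vertices, which
   for k vertices on one side forces t >= k.  If k = 3 and t = 3, every
   {u1, u2, w}-tree with u1, u2 opposite to w contains w u1 or w u2, so no three
   of them are edge-disjoint.  If k >= 4 and n is large, a k-colouring has a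
   monochromatic K_{2,k-2}; a rainbow tree on its vertices and one further
   vertex z uses at most one edge inside it and at most k - 2 edges at z, one
   too few.

   Upper bounds: by a union bound, for large n some t-colouring realizes every
   assignment of colours to at most K vertices of one side by edges to a vertex
   on the other side, even outside a prescribed set of M vertices.  With k + 1
   colours, S is spanned by rainbow double stars whose two centres are new
   vertices.  With 3 colours and S = {u1, u2, w}, the paths w u1 v u2 and
   w u2 v' u1 are two disjoint rainbow trees; for S on one side, use stars. *)

(** * Building, counting and packing rainbow trees *)

Lemma leq_card_bigcup (I T : finType) (F : I -> {set T}) :
  #|\bigcup_i F i| <= \sum_i #|F i|.
Proof.
elim/big_rec2: _ => [|i a A _ le]; first by rewrite cards0.
by rewrite cardsU (leq_trans (leq_subr _ _)) // leq_add2l.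
Qed.

Lemma sub_adjC (G : sgraph) (T : subgraph G) : symmetric (sub_adj T).
Proof. by move=> x y; rewrite /sub_adj /= setUC. Qed.

Lemma set2_inj (T : finType) (x y z : T) : [set x; y] = [set x; z] -> y = z.
Proof.
move=> e; have := set22 x y; rewrite e !inE => /orP[/eqP yx|/eqP //].
by have := set22 x z; rewrite -e yx !inE orbb => /eqP.
Qed.

(** All trees of the upper bounds are built here. Following [par] lowers [rank] until [r] is
    reached, which gives connectedness. A cycle would have two distinct edges at its vertex of
    maximal rank, but both would have to lead to the parent. *)
Lemma rooted_tree (G : sgraph) (V : {set G}) (r : G) (par : G -> G)
    (rank : G -> nat) :
    r \in V ->
    {in V :\ r, forall v,
       [/\ adj v (par v), par v \in V & rank (par v) < rank v]} ->
  exists T : subgraph G,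
    [/\ sub_verts T = V, sub_edges T = [set [set v; par v] | v in V :\ r]
      & is_tree T].
Proof.
move=> rV parP; set E := [set [set v; par v] | v in V :\ r].
have EG : E \subset edges G.
  apply/subsetP=> _ /imsetP[v /parP[av _ _] ->]; rewrite inE.
  by apply/existsP; exists v; apply/existsP; exists (par v); rewrite av eqxx.
have EV e : e \in E -> e \subset V.
  case/imsetP=> v vV ->; have [_ pV _] := parP v vV.
  by case/setD1P: vV => _ vV; rewrite subUset !sub1set vV.
pose T := Subgraph EG EV; exists T; split=> //; split.
- by apply/set0Pn; exists r.
- have to_r v : v \in V -> connect (sub_adj T) v r.
    elim: {v}(rank v).+1 {-2}v (ltnSn (rank v)) => // m IH v; rewrite ltnS => vm vV.
    have [-> //|vr] := eqVneq v r.
    have vVr : v \in V :\ r by rewrite !inE vr.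
    have [_ pV pv] := parP v vVr.
    apply: connect_trans (IH _ (leq_trans pv vm) pV).
    by apply: connect1; apply: imset_f.
  move=> x y /to_r xr /to_r yr; apply: connect_trans xr _.
  by rewrite (sym_connect_sym (sub_adjC T)).
- case=> p [p2 /andP[cp up]].
  (* Both cycle neighbours of a vertex of maximal rank must be its parent. *)
  have [x0 x0p] : exists x0, x0 \in p by case: p p2 {cp up} => // a p _; exists a; rewrite mem_head.
  pose x := [arg max_(x > x0 | x \in p) rank x].
  have [xp xmax] : x \in p /\ forall z, z \in p -> rank z <= rank x.
    by rewrite /x; case: arg_maxnP.
  have toP z : z \in p -> sub_adj T x z -> z = par x.
    move=> /xmax zx /imsetP[v vV exz].
    have [_ _ rv] := parP v vV.
    have : x \in [set v; par v] by rewrite -exz set21.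
    rewrite !inE => /orP[] /eqP xv; first by move: exz; rewrite -xv => /set2_inj.
    have zv : z = v by move: exz; rewrite -xv [RHS]setUC => /set2_inj.
    by move: rv; rewrite -xv -zv ltnNge zx.
  case: (rot_to xp) => i q eq.
  have mq z : z \in q -> z \in p by rewrite -(mem_rot i p) eq inE => ->; rewrite orbT.
  have {}p2 : 2 < size (x :: q) by rewrite -eq size_rot.
  have {}cp : cycle (sub_adj T) (x :: q) by rewrite -eq rot_cycle.
  have {up} : uniq (x :: q) by rewrite -eq rot_uniq.
  move: p2 cp.
  case: q eq mq => [|a [|b q]] //= eq mq _ /and3P[xa _ lx] /and4P[_ aq _ _].
  move: lx; rewrite rcons_path => /andP[_ lx].
  have lbq : last b q \in b :: q by rewrite mem_last.
  have aE : a = par x by apply: toP; rewrite ?mq ?mem_head.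
  have lE : last b q = par x.
    by apply: toP; [apply: mq; rewrite inE lbq orbT | rewrite sub_adjC].
  by move: aq; rewrite aE -lE lbq.
Qed.

(** A vertex set [A] grows from a root one vertex at a time, and every new vertex brings an edge
    that was not yet inside [A]. *)
Lemma card_verts_connected (G : sgraph) (T : subgraph G) :
  connected_sub T -> #|sub_verts T| <= #|sub_edges T|.+1.
Proof.
move=> cT; set V := sub_verts T; set E := sub_edges T.
have [->|[r rV]] := set_0Vmem V; first by rewrite cards0.
suff grow m : m < #|V| -> exists A : {set G},
    [/\ r \in A, A \subset V, #|A| = m.+1
      & m <= #|[set e in E | e \subset A]|].
  have := grow #|V|.-1; rewrite ltn_predL prednK; last by apply/card_gt0P; exists r.
  case=> [|A [_ _ _ le]]; first by apply/card_gt0P; exists r.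
  have /(leq_trans le) : #|[set e in E | e \subset A]| <= #|E|.
    by apply/subset_leq_card/subsetP=> e; rewrite inE => /andP[].
  by case: #|V|.
elim: m => [|m IH] mV.
  by exists [set r]; rewrite set11 sub1set rV cards1.
have [A [rA AV cA EA]] := IH (ltnW mV).
have [x xV xA] : exists2 x, x \in V & x \notin A.
  apply/subsetPn; apply/negP=> /subset_leq_card; rewrite cA leqNgt mV.
  by [].
(* A path from [r] in [A] to [x] outside [A] must cross the boundary of [A]. *)
have [y [z [yA zA yz]]] : exists y z, [/\ y \in A, z \notin A & sub_adj T y z].
  case/connectP: (cT r x rV xV) => p; move: (r) rA.
  elim: p => [|a p IHp] y yA /=; first by move=> _ xy; rewrite xy yA in xA.
  case/andP=> ya pa xl; have [aA|aA] := boolP (a \in A); first exact: IHp xl.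
  by exists y, a.
have zV : z \in V by apply: (subsetP (sub_endsP yz)); rewrite set22.
exists (z |: A); split.
- by rewrite !inE rA orbT.
- by rewrite subUset sub1set zV.
- by rewrite cardsU1 zA cA.
- apply: leq_ltn_trans EA _; apply: proper_card; apply/properP; split.
    apply/subsetP=> e; rewrite !inE => /andP[-> eA] /=.
    exact: subset_trans eA (subsetUr _ _).
  exists [set y; z]; rewrite !inE; last by rewrite subUset !sub1set (negPf zA) andbF andbF.
  by rewrite (yz : [set y; z] \in E) subUset !sub1set !inE yA eqxx orbT.
Qed.

Lemma card_rainbow_edges (G : sgraph) (T : subgraph G) t c :
  edge_coloring t c -> is_rainbow T c -> #|sub_edges T| <= t.
Proof.
move=> ct rT; rewrite cardE -(size_map c) -(size_iota 1 t).
apply: uniq_leq_size.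
  by rewrite map_inj_in_uniq ?enum_uniq // => x y; rewrite !mem_enum; apply: rT.
move=> i /mapP[e]; rewrite mem_enum => eT ->.
by rewrite mem_iota add1n ltnS; apply/ct/(subsetP (sub_edgesP T)).
Qed.

Lemma card_rainbow_verts (G : sgraph) (T : subgraph G) t c :
  edge_coloring t c -> is_tree T -> is_rainbow T c -> #|sub_verts T| <= t.+1.
Proof.
move=> ct [_ cT _] rT; apply: leq_trans (card_verts_connected cT) _.
exact: card_rainbow_edges ct rT.
Qed.

(** Vertices of [B] hang from [x], all others from [r], including [x] itself if it differs from [r];
    ranks 0, 1, 2 suffice. An empty [B] gives a star at [r], and a singleton [B] can give a path
    with four vertices. *)
Lemma double_star (G : sgraph) (V B : {set G}) (r x : G) (c : {set G} -> nat) :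
    r \in V -> x \in V -> r \notin B -> x \notin B ->
    {in V :\ r, forall v, adj v (if v \in B then x else r)} ->
    {in V :\ r &, injective (fun v => c [set v; if v \in B then x else r])} ->
  exists T : subgraph G,
    [/\ sub_verts T = V,
        sub_edges T = [set [set v; if v \in B then x else r] | v in V :\ r],
        is_tree T & is_rainbow T c].
Proof.
move=> rV xV rB xB adjV injV; pose par v := if v \in B then x else r.
have [|T [VT ET tT]] := @rooted_tree G V r par
    (fun v => if v == r then 0 else (v \in B).+1) rV.
  move=> v vV; split; first exact: adjV.
    by rewrite /par; case: ifP.
  case/setD1P: vV => /negPf /= -> _; rewrite /par.
  by case: (v \in B); rewrite ?eqxx // (negPf xB); case: ifP.
exists T; split=> //; rewrite /is_rainbow ET.
by move=> _ _ /imsetP[v vV ->] /imsetP[w wV ->] /(injV _ _ vV wV) ->.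
Qed.

(** The trees are chosen one by one, with [F] the set of vertices outside [S] used so far.
    Disjointness outside [S] also yields edge-disjointness: a common edge would have both ends in
    [S], which the last condition forbids. *)
Lemma greedy_trees (G : sgraph) (S : {set G}) (l d : nat) (c : {set G} -> nat) :
    (forall F : {set G}, #|F| <= l * d ->
       exists T : subgraph G,
         [/\ is_Stree T S, is_rainbow T c, #|sub_verts T :\: S| <= d,
             [disjoint sub_verts T :\: S & F]
           & forall e, e \in sub_edges T -> ~~ (e \subset S)]) ->
  exists T : 'I_l -> subgraph G,
    (forall i, is_Stree (T i) S /\ is_rainbow (T i) c) /\
    internally_disjoint S T.
Proof.
move=> ex; pose good T := [/\ is_Stree T S, is_rainbow T c,
  #|sub_verts T :\: S| <= d & forall e, e \in sub_edges T -> ~~ (e \subset S)].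
suff: exists T : nat -> subgraph G, (forall i, i < l -> good (T i)) /\
    forall i j, i < j < l -> [disjoint sub_verts (T j) :\: S & sub_verts (T i)].
  case=> T [gT dT]; exists (fun i => T (val i)); split.
    by move=> i; have [] := gT i (ltn_ord i).
  move=> i j ij; have [[_ Si] _ _ Ei] := gT i (ltn_ord i).
  have [[_ Sj] _ _ Ej] := gT j (ltn_ord j).
  have VS : sub_verts (T i) :&: sub_verts (T j) = S.
    apply/eqP; rewrite eqEsubset subsetI Si Sj !andbT; apply/subsetP=> v /setIP[vi vj].
    apply: contraT => vS; case: (ltngtP i j) => [lt|lt|e].
    - have /dT/disjointFl/(_ vi) : i < j < l by rewrite lt ltn_ord.
      by rewrite inE vS vj.
    - have /dT/disjointFl/(_ vj) : j < i < l by rewrite lt ltn_ord.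
      by rewrite inE vS vi.
    - by rewrite (val_inj e) eqxx in ij.
  split=> //; apply/setP=> e; rewrite !inE; apply/negP=> /andP[ei ej].
  by have /negP[] := Ei e ei; rewrite -VS subsetI !(sub_endsP _).
suff H m : m <= l -> exists T : nat -> subgraph G, (forall i, i < m -> good (T i)) /\
    forall i j, i < j < m -> [disjoint sub_verts (T j) :\: S & sub_verts (T i)].
  exact: H.
elim: m => [|m IH] ml.
  (* The sequence is total on [nat], so stage 0 needs some tree as a default value. *)
  have [|T0 _] := ex set0; first by rewrite cards0.
  by exists (fun=> T0); split=> // i j /andP[].
have [T [gT dT]] := IH (ltnW ml).
pose F := \bigcup_(i < m) (sub_verts (T i) :\: S).
have [|T' [St Rt dt Ft Et]] := ex F.
  apply: (@leq_trans (m * d)); last by rewrite leq_mul2r ltnW ?orbT.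
  apply: leq_trans (leq_card_bigcup _) _.
  rewrite -[m in m * d]card_ord -sum_nat_const; apply: leq_sum => i _.
  by have [] := gT i (ltn_ord i).
exists (fun i => if i == m then T' else T i); split=> [i|i j].
  by rewrite ltnS leq_eqVlt; case: eqVneq => [_ _|_ /= /gT].
rewrite ltnS => /andP[ij jm]; rewrite (ltn_eqF (leq_trans ij jm)).
case: eqVneq => [_|jm']; last by apply: dT; rewrite ij ltn_neqAle jm' jm.
rewrite disjoint_subset; apply/subsetP=> v vT; rewrite inE; apply/negP => vi.
have := disjointFr Ft vT; move: vT; rewrite inE => /andP[vS _].
move/negP; apply; apply/bigcupP.
by exists (Ordinal (leq_trans ij jm)) => //; rewrite inE vS.
Qed.

(** * Upper bounds for colourings with the extension property *)

Definition side n (v : Knn n) : bool := if v is inl _ then true else false.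

Lemma adj_side n (u v : Knn n) : adj u v = (side u != side v).
Proof. by case: u v => [i|i] [j|j]. Qed.

(** The bipartite, edge-coloured analogue of the extension axioms of random graphs. The set [Y]
    allows repeated choices of fresh vertices. *)
Definition extension n K M t (c : {set Knn n} -> nat) : Prop :=
  forall (s : bool) (X Y : {set Knn n}) (f : Knn n -> nat),
    {in X, forall v, side v = s} -> {in X, forall v, 1 <= f v <= t} ->
    #|X| <= K -> #|Y| <= M ->
  exists y, [/\ side y = ~~ s, y \notin Y & {in X, forall v, c [set v; y] = f v}].

(** The vertices of [S] receive the colours 1 to [k] in the order of [enum S], and the edge between
    the centres receives [k.+1]. The excluded set consists of at most [2 * l] earlier centres and
    the [k] vertices of [S]. *)
Lemma rainbow_connecting_double_star n k l c :
  @extension n k.+1 (2 * l + k) k.+1 c -> rainbow_connecting k l c.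
Proof.
move=> ext S Sk; apply: (@greedy_trees _ _ _ 2) => F; rewrite mulnC => Fl.
have FS : #|F :|: S| <= 2 * l + k.
  by rewrite cardsU Sk (leq_trans (leq_subr _ _)) // leq_add2r.
pose f v := (index v (enum S)).+1.
have fle v : v \in S -> 1 <= f v <= k.
  by move=> vS; rewrite /f /= -Sk cardE index_mem mem_enum.
have finj : {in S &, injective f}.
  by move=> u v uS vS []; apply: (index_inj u); rewrite mem_enum.
pose A := [set v in S | side v]; pose B := [set v in S | ~~ side v].
have [|||y [sy yFS yc]] := ext true A (F :|: S) f _ _ _ FS.
- by move=> v; rewrite inE => /andP[].
- by move=> v; rewrite inE => /andP[/fle]; lia.
- by rewrite -Sk leqW // subset_leq_card //; apply/subsetP=> v; rewrite inE => /andP[].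
have yS : y \notin S by apply: contra yFS; rewrite inE => ->; rewrite orbT.
(* The second centre is chosen after [y], since its edge to [y] is prescribed as well; hence up to
   [k.+1] prescribed edges. *)
have [|||x [sx xFS xc]] := ext false (y |: B) (F :|: S)
    (fun v => if v == y then k.+1 else f v) _ _ _ FS.
- by move=> v; rewrite !inE => /orP[/eqP ->|/andP[_ /negPf]].
- move=> v; rewrite !inE; case: eqP => [_ _|_ /=]; first by lia.
  by case/andP=> /fle; lia.
- rewrite cardsU1 (leq_add (leq_b1 _)) // -Sk subset_leq_card //.
  by apply/subsetP=> v; rewrite inE => /andP[].
have xS : x \notin S by apply: contra xFS; rewrite inE => ->; rewrite orbT.
have xy : x != y by apply/eqP=> e; move: sx; rewrite e sy.
have xB : x \notin B by rewrite inE (negPf xS).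
have yB : y \notin B by rewrite inE (negPf yS).
have VE v : v \in (x |: (y |: S)) :\ y -> v = x \/ [/\ v \in S, v != x & v != y].
  rewrite !inE => /andP[vy]; rewrite (negPf vy) /= => /orP[/eqP ->|vS]; first by left.
  by right; split=> //; apply: contraNneq xS => <-.
have cE v : v \in (x |: (y |: S)) :\ y ->
    c [set v; if v \in B then x else y] = if v == x then k.+1 else f v.
  move=> /VE[->|[vS /negPf -> vy]].
    by rewrite (negPf xB) eqxx setUC xc ?set11 ?eqxx // !inE eqxx.
  have [vB|vB] := boolP (v \in B); first by rewrite xc ?(negPf vy) // inE vB orbT.
  by rewrite yc // inE vS; move: vB; rewrite inE vS /= negbK.
have [||||||T [VT ET tT rT]] := @double_star (Knn n) (x |: (y |: S)) B y x c.
- by rewrite !inE eqxx orbT.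
- by rewrite !inE eqxx.
- by [].
- by [].
- move=> v /VE[->|[vS _ _]]; first by rewrite (negPf xB) adj_side sx sy.
  by rewrite adj_side inE vS /=; case sv: (side v); rewrite /= ?sx ?sy.
- move=> u v uV vV; rewrite /= !cE //.
  case: (VE u uV) => [->|[uS /negPf -> _]]; case: (VE v vV) => [->|[vS /negPf -> _]];
    rewrite ?eqxx //.
  + by move=> e; have := fle v vS; rewrite -e ltnn andbF.
  + by move=> e; have := fle u uS; rewrite e ltnn andbF.
  + exact: finj.
have VTS : sub_verts T :\: S \subset [set x; y].
  by rewrite VT; apply/subsetP=> v; rewrite !inE; case: (v \in S); rewrite //= !orbF.
exists T; split=> //.
- by split=> //; rewrite VT; apply/subsetP=> v vS; rewrite !inE vS !orbT.
- by rewrite (leq_trans (subset_leq_card VTS)) // cards2 xy.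
- apply: disjointWl VTS _; rewrite disjoint_subset; apply/subsetP=> v.
  by rewrite !inE => /orP[] /eqP ->; [move: xFS|move: yFS]; rewrite inE => /norP[].
- move=> e; rewrite ET => /imsetP[v vV ->].
  by rewrite subUset !sub1set negb_and; case: ifP; rewrite ?xS ?yS orbT.
Qed.

Lemma three_vertices_sides n (S : {set Knn n}) : #|S| = 3 ->
  (exists s, {in S, forall v, side v = s}) \/
  exists s u1 u2 w, [/\ S = [set u1; u2; w], u1 != u2, side u1 = s,
                        side u2 = s & side w = ~~ s].
Proof.
move=> S3; have /card_gt2P[a [b [d [[aS bS dS] [ab bd da]]]]] : 2 < #|S| by rewrite S3.
have SE : S = [set a; b; d].
  apply/esym/eqP; rewrite eqEcard S3 !subUset !sub1set aS bS dS /=.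
  by rewrite -setUA cardsU1 cards2 !inE negb_or ab bd eq_sym da.
have SE1 : S = [set a; d; b] by rewrite SE setUAC.
have SE2 : S = [set b; d; a] by rewrite SE -setUA setUC.
case sa: (side a); case sb: (side b); case sd: (side d).
- by left; exists true => v; rewrite SE !inE -orbA => /or3P[] /eqP ->.
- by right; exists true, a, b, d; split.
- by right; exists true, a, d, b; split=> //; rewrite eq_sym.
- by right; exists false, b, d, a; split.
- by right; exists true, b, d, a; split.
- by right; exists false, a, d, b; split=> //; rewrite eq_sym.
- by right; exists false, a, b, d; split.
- by left; exists false => v; rewrite SE !inE -orbA => /or3P[] /eqP ->.
Qed.

(** The colour of [w u1] is given, and the fresh vertex [v] is chosen so that [u1 v] and [u2 v] take
    the two other colours; the tree is the path [w u1 v u2]. The last conclusion serves to show that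
    the path obtained by exchanging [u1] and [u2] shares no edge with it. *)
Lemma rainbow_path n M c (s : bool) (u1 u2 w : Knn n) (Y : {set Knn n}) :
    edge_coloring 3 c -> extension 3 M 3 c -> u1 != u2 ->
    side u1 = s -> side u2 = s -> side w = ~~ s -> #|Y| <= M ->
    [set u1; u2; w] \subset Y ->
  exists T : subgraph (Knn n),
    [/\ is_Stree T [set u1; u2; w], is_rainbow T c,
        [disjoint sub_verts T :\: [set u1; u2; w] & Y]
      & forall e, e \in sub_edges T -> e \subset [set u1; u2; w] ->
          e = [set w; u1]].
Proof.
move=> c3 ext u12 s1 s2 sw YM; set S := [set u1; u2; w] => SY.
set a := c [set w; u1].
have a3 : 1 <= a <= 3.
  apply: c3; rewrite inE; apply/existsP; exists w; apply/existsP; exists u1.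
  by rewrite eqxx adj_side s1 sw; case: (s).
have [b [d [b3 d3 ab ad bd]]] : exists b d,
    [/\ 1 <= b <= 3, 1 <= d <= 3, a != b, a != d & b != d].
  exists (if a == 1 then 2 else 1), (if a == 3 then 2 else 3).
  by case: a a3 => [|[|[|[|a]]]].
have [||||v [sv vY vc]] := ext s [set u1; u2] Y (fun u => if u == u1 then b else d).
- by move=> v /set2P[] ->.
- by move=> v _ /=; case: ifP.
- by rewrite cards2 u12.
- by [].
have c1 : c [set u1; v] = b by rewrite vc ?set21 ?eqxx.
have c2 : c [set u2; v] = d by rewrite vc ?set22 // eq_sym (negPf u12).
have vS : v \notin S by apply: contra vY; apply: (subsetP SY).
move: (vS); rewrite !inE -orbA !negb_or => /and3P[v1 v2 vw].
have u1w : u1 != w by apply/eqP=> e; move: sw; rewrite -e s1; case: (s).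
have u2w : u2 != w by apply/eqP=> e; move: sw; rewrite -e s2; case: (s).
have VE z : z \in (v |: S) :\ v -> [\/ z = u1, z = u2 | z = w].
  rewrite !inE => /andP[/negPf -> /=]; rewrite -orbA.
  by case/or3P => /eqP; [constructor 1|constructor 2|constructor 3].
have p1 : (if u1 \in [set w] then u1 else v) = v by rewrite inE (negPf u1w).
have p2 : (if u2 \in [set w] then u1 else v) = v by rewrite inE (negPf u2w).
have pw : (if w \in [set w] then u1 else v) = u1 by rewrite inE eqxx.
have [||||||T [VT ET tT rT]] := @double_star (Knn n) (v |: S) [set w] v u1 c.
- by rewrite !inE eqxx.
- by rewrite !inE eqxx orbT.
- by rewrite inE.
- by rewrite inE.
- move=> z /VE[] ->; rewrite ?p1 ?p2 ?pw adj_side ?s1 ?s2 ?sv ?sw;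
    by case: (s).
- move=> z1 z2 /VE[] -> /VE[] -> //=;
    rewrite ?p1 ?p2 ?pw ?c1 ?c2 -/a => /eqP; rewrite ?(negPf ab) ?(negPf ad) ?(negPf bd) //;
    by rewrite eq_sym ?(negPf ab) ?(negPf ad) ?(negPf bd).
exists T; split=> //.
- by split=> //; rewrite VT subsetUr.
- rewrite VT setDUl setDv setU0 disjoint_subset; apply/subsetP=> z.
  by rewrite !inE => /andP[_ /eqP ->].
- move=> e; rewrite ET => /imsetP[z /VE[] -> ->]; rewrite ?p1 ?p2 ?pw //;
    by rewrite subUset !sub1set (negPf vS) andbF.
Qed.

(** If [S] lies on one side, [greedy_trees] packs two stars, avoiding 2 vertices besides the 3 of
    [S], whence the bound 5. If [S] meets both sides, the two paths have edges inside [S], so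
    [greedy_trees] does not apply; the second path avoids the at most 4 vertices of the first. *)
Lemma rainbow_connecting_three n c :
  edge_coloring 3 c -> @extension n 3 5 3 c -> rainbow_connecting 3 2 c.
Proof.
move=> c3 ext S S3; have := three_vertices_sides S3; case.
  case=> s sS; apply: (@greedy_trees _ _ _ 1) => F F2.
  pose f v := (index v (enum S)).+1.
  have finj : {in S &, injective f}.
    by move=> u v uS vS []; apply: (index_inj u); rewrite mem_enum.
  have [||||y [sy yFS yc]] := ext s S (F :|: S) f.
  - by [].
  - by move=> v vS; rewrite /f /= -S3 cardE index_mem mem_enum.
  - by rewrite S3.
  - by rewrite cardsU S3 (leq_trans (leq_subr _ _)) // (leq_add F2).
  move: (yFS); rewrite inE negb_or => /andP[yF yS].
  have VE : (y |: S) :\ y = S by apply: setU1K.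
  have pE v : (if v \in set0 then y else y) = y by case: ifP.
  have [||||||T [VT ET tT rT]] := @double_star (Knn n) (y |: S) set0 y y c.
  - by rewrite !inE eqxx.
  - by rewrite !inE eqxx.
  - by rewrite inE.
  - by rewrite inE.
  - by move=> v; rewrite VE pE adj_side sy => /sS ->; case: (s).
  - by move=> u v; rewrite VE /= !pE => uS vS; rewrite !yc //; apply: finj.
  have VTS : sub_verts T :\: S \subset [set y] by rewrite VT setDUl setDv setU0 subsetDl.
  exists T; split=> //.
  + by split=> //; rewrite VT subsetUr.
  + by rewrite -(cards1 y) subset_leq_card.
  + by apply: disjointWl VTS _; rewrite disjoints1.
  + move=> e; rewrite ET => /imsetP[v _ ->].
    by rewrite pE subUset !sub1set (negPf yS) andbF.
case=> s [u1 [u2 [w [SE u12 s1 s2 sw]]]].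
have SE' : [set u2; u1; w] = S by rewrite SE [[set u2; u1]]setUC.
have [||T1 [[t1 ST1] r1 d1 E1]] := rainbow_path c3 ext u12 s1 s2 sw (Y := S).
  by rewrite S3.
  by rewrite SE.
rewrite -SE in ST1 d1 E1.
have V1 := card_rainbow_verts c3 t1 r1.
have [||T2 [[t2 ST2] r2 d2 E2]] :=
    rainbow_path (u1 := u2) (u2 := u1) c3 ext _ s2 s1 sw (leqW V1).
  by rewrite eq_sym.
  by rewrite SE'.
rewrite SE' in ST2 d2 E2.
have V12 : sub_verts T1 :&: sub_verts T2 = S.
  apply/eqP; rewrite eqEsubset subsetI ST1 ST2 !andbT; apply/subsetP=> v /setIP[v1 v2].
  by have := disjointFl d2 v1; rewrite inE v2 andbT => /negbFE.
have E12 : sub_edges T1 :&: sub_edges T2 = set0.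
  apply/setP=> e; rewrite !inE; apply/negP=> /andP[e1 e2].
  have eS : e \subset S by rewrite -V12 subsetI !(sub_endsP _).
  have := E1 _ e1 eS; rewrite (E2 _ e2 eS) => /set2_inj u21.
  by rewrite u21 eqxx in u12.
have o1 (i : 'I_2) : i <> ord0 -> i = ord_max.
  by case: i => [[|[|//]] m] i0; [case: i0|]; apply: val_inj.
exists (fun i : 'I_2 => if i == ord0 then T1 else T2); split.
  by move=> i; case: ifP.
move=> i j ij; case: eqP => i0; case: eqP => j0.
- by rewrite i0 j0 eqxx in ij.
- by split.
- by rewrite setIC E12 setIC V12.
- by rewrite (o1 i) // (o1 j) // eqxx in ij.
Qed.

Lemma rainbow_connectingW (G : sgraph) (k l l' : nat) (c : {set G} -> nat) :
  l <= l' -> rainbow_connecting k l' c -> rainbow_connecting k l c.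
Proof.
move=> ll' rc S /rc[T [gT dT]]; exists (fun i => T (widen_ord ll' i)).
split=> // i j ij; apply: dT; apply: contra ij => /eqP e.
by apply/eqP/val_inj; apply: (congr1 val e).
Qed.

(** * Lower bounds *)

Lemma connected_edge (G : sgraph) (T : subgraph G) u v :
    connected_sub T -> u \in sub_verts T -> v \in sub_verts T -> u != v ->
  exists2 z, [set u; z] \in sub_edges T & z \in sub_verts T.
Proof.
move=> cT uT vT uv; case/connectP: (cT u v uT vT) => -[|z p] /=.
  by move=> _ vu; rewrite vu eqxx in uv.
case/andP=> uz _ _; exists z => //.
by apply: (subsetP (sub_endsP uz)); rewrite set22.
Qed.

Lemma sub_edges_adj (G : sgraph) (T : subgraph G) u v :
  [set u; v] \in sub_edges T -> adj u v.
Proof.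
move/(subsetP (sub_edgesP T)); rewrite inE => /existsP[x /existsP[y /andP[xy /eqP e]]].
have := set21 u v; rewrite e => /set2P[] uE; rewrite uE in e *.
  by rewrite (set2_inj e).
by rewrite [RHS]setUC in e; rewrite (set2_inj e) adj_sym.
Qed.

Lemma sub_edges_set2 (G : sgraph) (T : subgraph G) e :
  e \in sub_edges T -> exists u v, e = [set u; v].
Proof.
move/(subsetP (sub_edgesP T)); rewrite inE => /existsP[x /existsP[y /andP[_ /eqP ->]]].
by exists x, y.
Qed.

(** With two colours, a rainbow tree containing three vertices of one side has no further vertex,
    hence no edge. *)
Lemma three_colors_needed n l t : 2 < n -> 0 < l -> colors_suffice (Knn n) 3 l t -> 3 <= t.
Proof.
move=> n3 l0 [c [ct rc]]; rewrite leqNgt; apply/negP=> t2.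
pose u i : Knn n := inl (Ordinal (leq_trans (ltn_ord i) n3) : 'I_n).
have uI : injective u by move=> i j [] /val_inj.
pose S := [set u i | i : 'I_3].
have S3 : #|S| = 3 by rewrite card_imset // card_ord.
have [T [/(_ (Ordinal l0)) [[tT ST] rT] _]] := rc S S3.
have cT : connected_sub (T (Ordinal l0)) by case: tT.
have VT := card_rainbow_verts ct tT rT.
have VS : S = sub_verts (T (Ordinal l0)).
  by apply/eqP; rewrite eqEcard ST S3 (leq_trans VT).
have uS i : u i \in sub_verts (T (Ordinal l0)) by rewrite -VS imset_f.
have u01 : u ord0 != u ord_max by rewrite (inj_eq uI).
have [z /sub_edges_adj uz] := connected_edge cT (uS ord0) (uS ord_max) u01.
by rewrite -VS => /imsetP[i _ zi]; rewrite zi in uz.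
Qed.

Lemma four_colors_needed n l t : 1 < n -> 2 < l -> colors_suffice (Knn n) 3 l t -> 4 <= t.
Proof.
move=> n2 l3 [c [ct rc]]; rewrite leqNgt; apply/negP=> t3.
pose u1 : Knn n := inl (Ordinal (ltnW n2)); pose u2 : Knn n := inl (Ordinal n2).
pose w : Knn n := inr (Ordinal n2).
pose S := [set u1; u2; w].
have S3 : #|S| = 3 by rewrite /S -setUA cardsU1 cards2 !inE.
have [T [gT dT]] := rc S S3.
have wE i : ([set w; u1] \in sub_edges (T i)) || ([set w; u2] \in sub_edges (T i)).
  have [[tT ST] rT] := gT i; have cT : connected_sub (T i) by case: tT.
  have u1T : u1 \in sub_verts (T i) by apply: (subsetP ST); rewrite !inE eqxx.
  have u2T : u2 \in sub_verts (T i) by apply: (subsetP ST); rewrite !inE eqxx orbT.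
  have wT : w \in sub_verts (T i) by apply: (subsetP ST); rewrite !inE eqxx orbT.
  have [z wz zT] := connected_edge cT wT u1T isT.
  have [y u1y yT] := connected_edge cT u1T u2T isT.
  have [->|z1] := eqVneq u1 z; first by rewrite wz.
  have [->|z2] := eqVneq u2 z; first by rewrite wz orbT.
  have [->|yw] := eqVneq w y; first by rewrite setUC u1y.
  have sz := sub_edges_adj wz; have sy := sub_edges_adj u1y.
  (* Otherwise [w] has a neighbour [z] other than [u1] and [u2], and [u1] has a neighbour [y] other
     than [w]. This makes five vertices, while three colours allow four. *)
  suff: 4 < #|sub_verts (T i)| by rewrite ltnNge (leq_trans (card_rainbow_verts ct tT rT)).
  rewrite cardE; apply: (@uniq_leq_size _ [:: u1; u2; z; w; y]).
    rewrite /= !inE !negb_or /= z1 z2 yw /=.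
    by case: z y sz sy {wz zT z1 z2 u1y yT yw} => [z|z] [y|y].
  by move=> x; rewrite mem_enum !inE => /or4P[|||/orP[]] /eqP ->.
(* Three trees share two possible edges, so two of them contain the same one. *)
pose g (i : 'I_3) : bool := [set w; u1] \in sub_edges (T (widen_ord l3 i)).
have /injectivePn[i [j ij gij]] : ~~ injectiveb g.
  apply/negP=> /injectiveP/leq_card; rewrite card_bool card_ord.
  by [].
have [|E _] := dT (widen_ord l3 i) (widen_ord l3 j).
  by apply: contra ij => /eqP e; apply/eqP/val_inj; apply: (congr1 val e).
have N e : e \in sub_edges (T (widen_ord l3 i)) -> e \in sub_edges (T (widen_ord l3 j)) -> False.
  by move=> ei ej; have := in_set0 e; rewrite -E inE ei ej.
move: (wE (widen_ord l3 i)) (wE (widen_ord l3 j)); rewrite -!/(g _).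
have [gj _ _|gj] := boolP (g j); first by apply: (N [set w; u1]); first rewrite -/(g i) gij.
by rewrite gij (negPf gj); apply: N.
Qed.

(** Fix [t.+2] vertices on one side. Each vertex [w] of the other side sees two of them in the same
    colour, and for large [n] some choice of pair and colour occurs for more than [m] vertices [w].
    Colours are stored in ['I_t.+1], with 0 unattained, which is why [t.+2] vertices are taken. *)
Lemma monochromatic_K2m t m : exists N, forall n, N <= n ->
  forall c, edge_coloring (G := Knn n) t c ->
  exists (u1 u2 : 'I_n) (R : {set 'I_n}) (a : nat),
    [/\ u1 != u2, #|R| = m &
        {in R, forall w, c [set inl u1; inr w] = a /\ c [set inl u2; inr w] = a}].
Proof.
exists (t.+2 + (t.+2 * t.+2 * t.+1 * m.+1)) => n nN c ct.
have tn : t.+1 < n by apply: leq_trans nN; rewrite leq_addr.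
pose u (i : 'I_t.+2) : 'I_n := widen_ord tn i.
pose col (v w : 'I_n) := c [set inl v; inr w].
have colt v w : 1 <= col v w <= t.
  apply: ct; rewrite inE; apply/existsP; exists (inl v).
  by apply/existsP; exists (inr w); rewrite eqxx.
pose F (p : 'I_t.+2 * 'I_t.+2 * 'I_t.+1) := [set w : 'I_n |
  [&& p.1.1 != p.1.2, col (u p.1.1) w == p.2 & col (u p.1.2) w == p.2]].
have cover : \bigcup_p F p = setT.
  apply/setP=> w; rewrite inE; apply/bigcupP.
  pose g (i : 'I_t.+2) : 'I_t.+1 := inord (col (u i) w).
  have gE i : g i = col (u i) w :> nat by rewrite inordK // ltnS; case/andP: (colt (u i) w).
  have /injectivePn[i [j ij gij]] : ~~ injectiveb g.
    by apply/negP=> /injectiveP/leq_card; rewrite !card_ord ltnn.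
  by exists (i, j, g i); rewrite // inE ij /= gE -(gE j) -gij gE !eqxx.
(* Strictness makes [F p] nonempty even for [m = 0]; a member of it certifies that the two indices
   differ. *)
have [p pm] : exists p, m < #|F p|.
  apply/existsP; apply: contraLR nN => /existsPn Fm; rewrite -ltnNge.
  apply: (@leq_ltn_trans (t.+2 * t.+2 * t.+1 * m)); last by nia.
  rewrite -[n in n <= _]card_ord -cardsT -cover.
  apply: leq_trans (leq_card_bigcup _) _.
  have -> : t.+2 * t.+2 * t.+1 = #|{: 'I_t.+2 * 'I_t.+2 * 'I_t.+1}|.
    by rewrite !card_prod !card_ord.
  rewrite -sum_nat_const; apply: leq_sum => q _.
  by rewrite leqNgt Fm.
have [w] : exists w, w \in F p by apply/card_gt0P; apply: leq_trans pm.
rewrite inE => /and3P[p12 _ _].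
have /card_geqP[s [us sm sF]] := ltnW pm.
exists (u p.1.1), (u p.1.2), [set x in s], p.2; split.
- by apply: contra p12 => /eqP e; apply/eqP/val_inj; apply: (congr1 val e).
- by rewrite cardsE (card_uniqP us).
- by move=> x; rewrite inE => /sF; rewrite inE => /and3P[_ /eqP ? /eqP ?].
Qed.

Lemma k_colors_insufficient k l t : 3 < k -> 0 < l -> t <= k ->
  exists N, forall n, N <= n -> ~ colors_suffice (Knn n) k l t.
Proof.
move=> k4 l0 tk; have [N HN] := monochromatic_K2m t (k - 2); exists N.
move=> n /HN{HN}HN [c [ct rc]]; have [u1 [u2 [R [a [u12 Rk Ra]]]]] := HN c ct.
pose U : {set Knn n} := [set inl u1; inl u2].
pose W : {set Knn n} := [set inr w | w in R]; pose S := U :|: W.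
have Wk : #|W| = k - 2 by rewrite card_imset // => i j [].
have U2 : #|U| = 2 by rewrite cards2 (inj_eq (f := inl)) ?u12 // => i j [].
have sU v : v \in U -> side v by rewrite !inE => /orP[] /eqP ->.
have sW v : v \in W -> ~~ side v by case/imsetP=> i _ ->.
have Sk : #|S| = k.
  have UW : U :&: W = set0.
    by apply/setP=> v; rewrite in_setI in_set0; apply/negP=> /andP[/sU sv /sW]; rewrite sv.
  by rewrite cardsU UW cards0 U2 Wk; lia.
have [T' [/(_ (Ordinal l0)) + _]] := rc S Sk.
set T := T' _ => -[[tT ST] rT].
have VT := card_rainbow_verts ct tT rT.
have VE : #|sub_verts T| <= #|sub_edges T|.+1 by apply: card_verts_connected; case: tT.
pose E1 := [set e in sub_edges T | e \subset S].
(* All edges of the graph inside [S] have colour [a], so a rainbow tree uses at most one. *)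
have E1le : #|E1| <= 1.
  have E1c e : e \in E1 -> c e = a.
    rewrite inE => /andP[eT eS]; have [x [y ee]] := sub_edges_set2 eT.
    move: eT eS; rewrite {}ee => /sub_edges_adj xy; rewrite subUset !sub1set => /andP[xS yS].
    have mono v w : v \in U -> w \in W -> c [set v; w] = a.
      by move=> /set2P[] -> /imsetP[i /Ra[? ?] ->].
    move: xS yS xy; rewrite adj_side => /setUP[] xS /setUP[] yS.
    - by rewrite !sU.
    - by move=> _; apply: mono.
    - by move=> _; rewrite setUC; apply: mono.
    - by rewrite (negPf (sW _ xS)) (negPf (sW _ yS)).
  apply/card_le1_eqP => e f; rewrite !inE => /andP[eT eS] /andP[fT fS].
  by apply: rT; rewrite ?E1c // inE ?eT ?fT.
have VS : #|sub_verts T :\: S| <= 1.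
  by rewrite cardsD (setIidPr ST) Sk; lia.
have EE : #|sub_edges T| = #|E1| + #|sub_edges T :\: E1|.
  rewrite -(cardsID E1 (sub_edges T)); congr (#|pred_of_set _| + _).
  by apply/setIidPr/subsetP=> e; rewrite inE => /andP[].
(* Without a further vertex the tree has at most one edge, too few for [k] vertices. With [z], it
   has [k.+1] vertices but at most [1 + (k - 2)] edges. *)
have [VS0|[z zVS]] := set_0Vmem (sub_verts T :\: S).
  have E2 : sub_edges T :\: E1 = set0.
    apply/setP=> e; rewrite !inE; apply/negP=> /andP[+ eT]; rewrite eT /= => /negP; apply.
    by apply: subset_trans (sub_endsP eT) _; rewrite -setD_eq0 VS0.
  by have := subset_leq_card ST; move: EE; rewrite E2 cards0; lia.
have VSz v : v \in sub_verts T -> v \notin S -> v = z.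
  by move=> vT vS; apply: (card_le1_eqP VS) => //; rewrite inE vS.
(* The possible neighbours of [z] in [S] form [U] or [W]; for [U] the bound [2 <= k - 2] uses
   [3 < k]. *)
pose D := [set v in S | side v != side z].
have Dk : #|D| <= k - 2.
  case sz: (side z).
    rewrite -Wk subset_leq_card //; apply/subsetP=> v; rewrite inE sz => /andP[/setUP[] //].
    by move/sU ->.
  apply: (@leq_trans #|U|); last by rewrite U2; lia.
  rewrite subset_leq_card //; apply/subsetP=> v; rewrite inE sz => /andP[/setUP[] //].
  by move/sW/negPf ->.
have E2 : #|sub_edges T :\: E1| <= #|D|.
  apply: leq_trans (leq_imset_card (fun v => [set z; v]) _).
  apply: subset_leq_card; apply/subsetP=> e; rewrite !inE => /andP[+ eT]; rewrite eT /=.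
  have [x [y ee]] := sub_edges_set2 eT; have := sub_endsP eT; move: eT; rewrite ee.
  move=> /sub_edges_adj; rewrite adj_side !subUset !sub1set => xy /andP[xT yT].
  have [xS /= yS|xS _] := boolP (x \in S).
    rewrite (VSz y) // setUC in xy *; apply: imset_f; rewrite inE xS; exact: xy.
  have [yS|yS] := boolP (y \in S); last first.
    by rewrite (VSz y) // (VSz x) // eqxx in xy.
  by rewrite (VSz x) // in xy *; apply: imset_f; rewrite inE yS eq_sym.
have : #|sub_verts T| = k.+1.
  have : 0 < #|sub_verts T :\: S| by apply/card_gt0P; exists z.
  by rewrite cardsD (setIidPr ST) Sk; lia.
by move: EE VE; lia.
Qed.

(** * Existence of colourings with the extension property, by counting *)

Lemma polynomial_lt_exponential C D p :
  exists N, forall m, N <= m -> C * m ^ D * p ^ m < p.+1 ^ m.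
Proof.
(* Bernoulli's inequality [(1 + 1/p)^r >= 1 + r/p], cleared of denominators and weakened to
   [r/p]. *)
have bernoulli r : p ^ r * r <= p.+1 ^ r * p.
  apply: (@leq_trans (p ^ r * (p + r))); first by rewrite leq_mul2l leq_addl orbT.
  elim: r => [|r IH]; first by rewrite !expn0 addn0.
  rewrite !expnS -(mulnA p.+1); apply: leq_trans (leq_mul (leqnn p.+1) IH).
  by move: (p ^ r) => x; nia.
case: p bernoulli => [|p'] bernoulli.
  by exists 1 => m m0; rewrite exp0n // muln0 expn_gt0.
set p := p'.+1 in bernoulli *.
(* Raising [bernoulli] for [r = m %/ D.+1] to the power [D.+1] gives [(1 + 1/p)^m >= (r/p)^(D+1)].
   Since [m <= 2 * D.+1 * r], this exceeds [C * m ^ D] as soon as [r > B]. *)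
pose B := C * (2 * D.+1) ^ D * p ^ D.+1; exists (D.+1 * B.+1) => m mN.
pose r := m %/ D.+1; have rB : B < r by rewrite leq_divRL // mulnC.
have mr : m <= 2 * D.+1 * r.
  have := divn_eq m D.+1; have := ltn_pmod m (ltn0Sn D); rewrite -/r; nia.
have key : p ^ m * r ^ D.+1 <= p.+1 ^ m * p ^ D.+1.
  rewrite [in p ^ m](divn_eq m D.+1) [in p.+1 ^ m](divn_eq m D.+1) -/r !expnD !expnM.
  rewrite mulnAC [X in _ <= X]mulnAC -!expnMn; apply: leq_mul.
    by rewrite leq_exp2r.
  by case: (m %% _) => [|s]; rewrite ?expn0 // leq_exp2r.
rewrite -(@ltn_pmul2r (p ^ D.+1)) ?expn_gt0 //; apply: leq_trans key.
rewrite -mulnA [p ^ m * _]mulnC mulnA [X in _ < X]mulnC ltn_pmul2r ?expn_gt0 //.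
rewrite [r ^ _]expnS; apply: (@leq_ltn_trans (B * r ^ D)).
  rewrite /B [X in _ <= X]mulnAC leq_mul // -mulnA -expnMn leq_mul //.
  by case: (D) mr => [|D'] mr; rewrite ?expn0 // leq_exp2r.
by rewrite ltn_pmul2r // expn_gt0; apply/orP; left; apply: leq_ltn_trans rB.
Qed.

Lemma card_familyE (aT rT : finType) (F : aT -> pred rT) :
  #|(family F : {pred {ffun aT -> rT}})| = \prod_x #|F x|.
Proof. by rewrite card_family foldrE big_map big_enum. Qed.

Section Counting.
Variables (n K M t : nat).
Hypothesis t0 : 0 < t.
Implicit Types (p : {ffun 'I_K -> 'I_n * 'I_t}) (b : {ffun 'I_M -> 'I_n}).

(* [p] encodes a prescription of colours on at most [K] points (the first pair
   wins if a point is repeated) and the image of [b] a set of excluded points. *)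
Definition fits p : {pred {ffun 'I_n -> 'I_t}} :=
  family (fun u => [pred x | if [pick i | (p i).1 == u] is Some i then x == (p i).2 else true]).

Definition bad p b : {pred {ffun 'I_n -> {ffun 'I_n -> 'I_t}}} :=
  family (fun w => [pred m | (w \in [set b i | i : 'I_M]) || (m \notin fits p)]).

(** At most [K] entries of a row are prescribed, so a proportion of at least [t ^ -K] of all rows
    fits. The product form also covers [K > n]. *)
Lemma card_fits p : t ^ n <= #|fits p| * t ^ K.
Proof.
rewrite card_familyE; pose X := [set (p i).1 | i : 'I_K].
have XK : #|X| <= K by rewrite -[K in _ <= K]card_ord leq_imset_card.
rewrite -[n in t ^ n]card_ord -prod_nat_const (bigID (mem X)) mulnC /= prod_nat_const.
rewrite [X in _ <= _ * X](bigID (mem X)) /=; apply: leq_mul; first by rewrite leq_pexp2l.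
rewrite -[X in X <= _]mul1n; apply: leq_mul.
  rewrite prodn_cond_gt0 // => u _; apply/card_gt0P; case: pickP => [i _|_] /=.
    by exists (p i).2; apply: eqxx.
  by exists (Ordinal t0).
apply: leq_prod => u uX; case: pickP => [i /eqP iu|_] /=.
  by case/imsetP: uX; exists i.
by rewrite -[t in t <= _]card_ord; apply/subset_leq_card/subsetP.
Qed.

(** At least [n - M] rows lie outside the image of [b]; each misses [p] with proportion at most
    [1 - 1/q], where [q = t ^ K], and rows are independent. *)
Lemma card_bad p b : M <= n ->
  #|bad p b| * (t ^ K) ^ (n - M) <= (t ^ n) ^ n * (t ^ K).-1 ^ (n - M).
Proof.
move=> Mn; set q := t ^ K; have q0 : 0 < q by rewrite expn_gt0 t0.
pose X := [set b i | i : 'I_M].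
have XM : #|X| <= M by rewrite -[M in _ <= M]card_ord leq_imset_card.
(* If [b] is not injective, more than [n - M] rows are constrained; the [e] extra factors are
   bounded by [q.-1 <= q]. *)
have [e de] : exists e, n - #|X| = n - M + e.
  by exists (M - #|X|); lia.
have CX : #|~: X| = n - #|X| by rewrite cardsCs setCK card_ord.
suff : #|bad p b| * q ^ (n - #|X|) <= (t ^ n) ^ n * q.-1 ^ (n - #|X|).
  rewrite de !expnD !mulnA => le; rewrite -(@leq_pmul2r (q ^ e)) ?(expn_gt0 q) ?q0 //.
  apply: leq_trans le _; rewrite leq_mul2l; apply/orP; right.
  by case: (e) => [|e']; rewrite ?expn0 // leq_exp2r // leq_pred.
rewrite card_familyE -CX -!prod_nat_const.
rewrite -[X in _ <= (_ ^ X) * _]card_ord -prod_nat_const.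
rewrite (bigID (mem X)) [X in _ <= X * _](bigID (mem X)) /= -!mulnA; apply: leq_mul.
  apply: leq_prod => w wX; rewrite -[t ^ n](_ : #|{ffun 'I_n -> 'I_t}| = _); last first.
    by rewrite card_ffun !card_ord.
  exact: max_card.
have E (f : 'I_n -> nat) : \prod_(w in ~: X) f w = \prod_(w | w \notin X) f w.
  by apply: eq_bigl => w; rewrite inE.
rewrite !E -!big_split /=; apply: leq_prod => w wX.
have -> : #|[pred m | (w \in [set b i | i : 'I_M]) || (m \notin fits p)]| = t ^ n - #|fits p|.
  have -> : t ^ n = #|{ffun 'I_n -> 'I_t}| by rewrite card_ffun !card_ord.
  rewrite -(cardC (fits p)) addKn; apply: eq_card => m.
  by rewrite [LHS]unfold_in /= -/X (negPf wX) inE.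
rewrite mulnBl -subn1 mulnBr muln1 leq_sub2l //; exact: card_fits.
Qed.

End Counting.

Definition rows_realize n t K M (m : 'I_n -> 'I_n -> 'I_t) : Prop :=
  forall (A B : {set 'I_n}) (f : 'I_n -> 'I_t), #|A| <= K -> #|B| <= M ->
  exists2 w, w \notin B & {in A, forall u, m w u = f u}.

Lemma rows_realize_not_bad n t K M (m : {ffun 'I_n -> {ffun 'I_n -> 'I_t}}) :
  0 < n -> (forall p b, m \notin @bad n K M t p b) -> rows_realize K M (fun w u => m w u).
Proof.
move=> n0 nb A B f AK BM; pose z := Ordinal n0.
(* The padding by [z] is harmless: in [p] it prescribes the value [f z] at [z], in agreement with
   [f], and in [b] it only excludes one more row. *)
pose p : {ffun 'I_K -> 'I_n * 'I_t} :=
  [ffun i : 'I_K => let u := nth z (enum A) i in (u, f u)].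
pose b : {ffun 'I_M -> 'I_n} := [ffun i : 'I_M => nth z (enum B) i].
have /forallPn[w] := nb p b; rewrite unfold_in /= negb_or negbK.
case/andP=> wb mw; exists w.
  apply: contra wb => wB; have wM : index w (enum B) < M.
    by apply: leq_trans BM; rewrite cardE index_mem mem_enum.
  by apply/imsetP; exists (Ordinal wM); rewrite // ffunE /= nth_index ?mem_enum.
move=> u uA; have uK : index u (enum A) < K.
  by apply: leq_trans AK; rewrite cardE index_mem mem_enum.
have /forallP/(_ u) := mw; rewrite unfold_in /=.
case: pickP => [i|/(_ (Ordinal uK))]; rewrite ffunE /=.
  by move=> /eqP -> /eqP.
by rewrite nth_index ?mem_enum ?eqxx.
Qed.

(** A union bound: the pairs [(p, b)] number [(n * t) ^ K * n ^ M], polynomial in [n], while each is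
    bad for an exponentially small proportion of matrices. Transposed matrices are counted too, so
    that rows and columns are handled at once. *)
Lemma realizing_matrix K M t : 0 < t -> exists N, forall n, N <= n ->
  exists m : 'I_n -> 'I_n -> 'I_t,
    rows_realize K M m /\ rows_realize K M (fun u w => m w u).
Proof.
(* In [C], the factor 2 accounts for the transpose, [t ^ K] for the colours in [p], and
   [2 ^ (K + M)] for replacing [n] by [d = n - M], where [n <= 2 * d]. *)
move=> t0; pose q := t ^ K; pose C := 2 * t ^ K * 2 ^ (K + M).
have [N0 HN] := polynomial_lt_exponential C (K + M) q.-1.
have q0 : 0 < q by rewrite expn_gt0 t0.
exists (N0 + 2 * M + 1) => n nN; pose d := n - M.
have n2d : n <= 2 * d by rewrite /d; lia.
have Mn : M <= n by lia.
pose P := ({ffun 'I_K -> 'I_n * 'I_t} * {ffun 'I_M -> 'I_n})%type.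
pose BR := \bigcup_(pb : P) [set m | m \in bad pb.1 pb.2].
have BRle : #|BR| * q ^ d <= (n * t) ^ K * n ^ M * ((t ^ n) ^ n * q.-1 ^ d).
  apply: leq_trans (_ : (\sum_(pb : P) #|bad pb.1 pb.2|) * q ^ d <= _).
    rewrite leq_mul2r; apply/orP; right; apply: leq_trans (leq_card_bigcup _) _.
    by apply: leq_sum => pb _; rewrite cardsE.
  rewrite big_distrl /=.
  have -> : (n * t) ^ K * n ^ M = #|{: P}|.
    by rewrite card_prod !card_ffun card_prod !card_ord.
  by rewrite -sum_nat_const; apply: leq_sum => pb _; apply: card_bad.
pose tr (m : {ffun 'I_n -> {ffun 'I_n -> 'I_t}}) := [ffun w => [ffun u => m u w]].
have trK : involutive tr by move=> m; apply/ffunP=> w; apply/ffunP=> u; rewrite !ffunE.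
have lt2 : #|BR :|: [set m | tr m \in BR]| < #|{ffun 'I_n -> {ffun 'I_n -> 'I_t}}|.
  apply: (@leq_ltn_trans (2 * #|BR|)).
    rewrite cardsU (leq_trans (leq_subr _ _)) // mul2n -addnn leq_add2l.
    rewrite -(card_imset _ (inv_inj trK)) subset_leq_card //.
    apply/subsetP=> _ /imsetP[m + ->]; rewrite inE => mB.
    by apply: mB.
  have -> : #|{ffun 'I_n -> {ffun 'I_n -> 'I_t}}| = (t ^ n) ^ n.
    by rewrite !card_ffun !card_ord.
  rewrite -(@ltn_pmul2r (q ^ d)) ?(expn_gt0 q) ?q0 // -mulnA.
  apply: leq_ltn_trans (leq_mul (leqnn 2) BRle) _.
  have := HN d _; rewrite prednK // => /(_ ltac:(lia)) lt.
  rewrite -(@ltn_pmul2l ((t ^ n) ^ n)) in lt; last by rewrite !expn_gt0 t0.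
  apply: leq_ltn_trans lt; have nD : n ^ K * n ^ M <= 2 ^ (K + M) * d ^ (K + M).
    rewrite -expnD -expnMn.
    by case: (K + M) => [|D]; rewrite ?expn0 // leq_exp2r.
  rewrite /C expnMn; move: nD; move: (n ^ K) (n ^ M) (2 ^ _) (d ^ _) => a1 a2 a3 a4 nD.
  move: ((t ^ n) ^ n) (t ^ K) (q.-1 ^ d) => T tK Q.
  have -> : 2 * (a1 * tK * a2 * (T * Q)) = 2 * tK * T * Q * (a1 * a2) by lia.
  have -> : T * (2 * tK * a3 * a4 * Q) = 2 * tK * T * Q * (a3 * a4) by lia.
  by rewrite leq_mul2l nD orbT.
have [m mB] : exists m, m \notin BR :|: [set m | tr m \in BR].
  apply/existsP; apply: contraLR lt2 => /existsPn mB; rewrite -leqNgt.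
  by apply/subset_leq_card/subsetP=> m _; apply/negbNE.
move: mB; rewrite !inE negb_or => /andP[m1 m2].
have nb m' : m' \notin BR ->
    forall (p : {ffun 'I_K -> 'I_n * 'I_t}) (b : {ffun 'I_M -> 'I_n}),
      m' \notin bad p b.
  by move=> mB p b; apply: contra mB => mpb; apply/bigcupP; exists (p, b); rewrite ?inE.
have n0 : 0 < n by lia.
exists (fun w u => m w u); split; first exact: rows_realize_not_bad n0 (nb _ m1).
move=> A B f AK BM; have [w wB wA] := rows_realize_not_bad n0 (nb _ m2) f AK BM.
by exists w => // u /wA; rewrite !ffunE.
Qed.

Lemma extension_coloring K M t : 0 < t -> exists N, forall n, N <= n ->
  exists c, edge_coloring (G := Knn n) t c /\ extension K M t c.
Proof.
move=> t0; have [N HN] := realizing_matrix K M t0; exists N => n /HN[m [mr ml]].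
pose c (e : {set Knn n}) : nat :=
  if [pick p : 'I_n * 'I_n | e == [set inl p.1; inr p.2]] is Some p
  then (m p.2 p.1).+1 else 1.
have cE u w : c [set inl u; inr w] = (m w u).+1.
  rewrite /c; case: pickP => [[u' w'] /= /eqP e|/(_ (u, w))]; last by rewrite eqxx.
  have := set21 (inl u : Knn n) (inr w); rewrite e => /set2P[] // [] <-.
  by have := set22 (inl u : Knn n) (inr w); rewrite e => /set2P[] // [] <-.
exists c; split.
  by move=> e _; rewrite /c; case: pickP => [p _|_ //]; rewrite /= ltn_ord.
have card_inj (h : 'I_n -> Knn n) (Z : {set Knn n}) k : injective h ->
    #|Z| <= k -> #|h @^-1: Z| <= k.
  move=> hI; apply: leq_trans; rewrite -(card_imset _ hI) subset_leq_card //.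
  by apply/subsetP=> _ /imsetP[i + ->]; rewrite inE.
have inlI : injective (inl : 'I_n -> Knn n) by move=> i j [].
have inrI : injective (inr : 'I_n -> Knn n) by move=> i j [].
(* Colours are shifted by one between ['I_t] and 1 to [t]; [insubd] supplies a default where [f],
   off [X], is out of range. *)
have ordE x : 1 <= x <= t -> (insubd (Ordinal t0) x.-1 : 'I_t).+1 = x.
  by case: x => // x xt; rewrite insubdK.
move=> [] X Y f sX fX XK YM.
- have [w wY wX] := mr (inl @^-1: X) (inr @^-1: Y)
    (fun u => insubd (Ordinal t0) (f (inl u)).-1) (card_inj _ _ _ inlI XK) (card_inj _ _ _ inrI YM).
  exists (inr w); split=> //; first by rewrite inE in wY.
  move=> [u|u] uX; last by have := sX _ uX.
  by rewrite cE wX ?inE // ordE //; apply: fX.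
- have [u uY uX] := ml (inr @^-1: X) (inl @^-1: Y)
    (fun w => insubd (Ordinal t0) (f (inr w)).-1) (card_inj _ _ _ inrI XK) (card_inj _ _ _ inlI YM).
  exists (inl u); split=> //; first by rewrite inE in uY.
  move=> [w|w] wX; first by have := sX _ wX.
  by rewrite setUC cE uX ?inE // ordE //; apply: fX.
Qed.

(** * Combining the bounds *)

Lemma colors_sufficeW (G : sgraph) k l t t' :
  t <= t' -> colors_suffice G k l t -> colors_suffice G k l t'.
Proof.
move=> tt' [c [ct rc]]; exists c; split=> // e /ct /andP[-> /leq_trans]; exact.
Qed.

Theorem theorem2p4 (k l : nat) (hk : 3 <= k) (hl : 0 < l) :
  exists N : nat, 0 < N /\
    forall n : nat, N <= n ->
      [/\ (k = 3 /\ (l = 1 \/ l = 2) -> rainbow_index (Knn n) k l 3),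
          (k = 3 /\ 3 <= l -> rainbow_index (Knn n) k l 4)
        & (4 <= k -> rainbow_index (Knn n) k l k.+1)].
Proof.
have [N1 H1] := extension_coloring 3 5 (isT : 0 < 3).
have [N2 H2] := extension_coloring k.+1 (2 * l + k) (ltn0Sn k).
(* The condition [3 < k] is placed under the existential so that [N3] is available for [k = 3]
   too. *)
have [N3 H3] : exists N, 3 < k -> forall n, N <= n -> ~ colors_suffice (Knn n) k l k.
  case: (ltnP 3 k) => [k3|_]; last by exists 0.
  by have [N H] := k_colors_insufficient k3 hl (leqnn k); exists N.
exists (N1 + N2 + N3 + 3); split=> [|n nN]; first by rewrite addn3.
(* This also gives the bound 4 for [k = 3] and every [l]. *)
have upper : colors_suffice (Knn n) k l k.+1.
  have [|c [ck ext]] := H2 n; first by lia.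
  by exists c; split=> //; apply: rainbow_connecting_double_star ext.
split=> [[k3 l12]|[k3 l3]|k4]; split.
- have [|c [c3 ext]] := H1 n; first by lia.
  exists c; split=> //; rewrite k3; have l2 : l <= 2 by case: l12 => ->.
  by apply: rainbow_connectingW l2 _; apply: rainbow_connecting_three.
- by rewrite k3 => t'; apply: three_colors_needed => //; lia.
- by move: upper; rewrite k3.
- by rewrite k3 => t'; apply: four_colors_needed => //; lia.
- exact: upper.
- move=> t' ht'; rewrite ltnNge; apply/negP=> t'k.
  by apply: (H3 k4 n); [lia | apply: colors_sufficeW ht'].
Qed.
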